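(* There are at most 4 congruence classes of 3-point unequally spaced meshes with Euclidean curvature $\kappa$ and side lengths $\mathsf d_1$ and $\mathsf d_2$ (where $\mathsf d_2>\mathsf d_1$), classified as follows. a) If $\kappa\cdot\mathsf d_2=2$ (meaning that the bigger side $\mathsf d_2$ is the diameter of the circumcircle), there exist 2 congruence classes: one in $SD$, denoted by $\gamma^{\vartriangle}_{\kappa,\mathsf d_1,SD}$, and another in $\sim SD$, denoted by $\gamma^{\vartriangle}_{\kappa,\mathsf d_1,\sim SD}$. b) If $\kappa\cdot\mathsf d_2\neq 2$, there exist 4 congruence classes: two in $SD$, denoted by $\{\gamma^{\vartriangle,1}_{\kappa,\mathsf d_1,\mathsf d_2,SD},\gamma^{\vartriangle,2}_{\kappa,\mathsf d_1,\mathsf d_2,SD}\}$, and the other two in $\sim SD$, denoted by $\{\gamma^{\vartriangle,3}_{\kappa,\mathsf d_1,\mathsf d_2,\sim SD},\gamma^{\vartriangle,4}_{\kappa,\mathsf d_1,\mathsf d_2,\sim SD}\}$.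
   Context: Meshes are taken in $M^{S\mathbb{E}}$, the space of all planar ordinary meshes acted on by $S\mathbb{E}(2)=SO(2)\ltimes\mathbb{R}^2$. A 3-point mesh is an ordered triple $\{p_1,p,p_2\}$ of successive points of $\mathbb{R}^2$; it is ordinary if it has no cusp, i.e. $p_1\neq p_2$. Its side lengths are $\mathsf d_1=|p_1-p|$ (first to middle point) and $\mathsf d_2=|p_2-p|$ (end to middle point); it is equally spaced if these are equal and unequally spaced otherwise. Two meshes $\{p_1,p,p_2\}$, $\{q_1,q,q_2\}$ are congruent if some $g\in S\mathbb{E}(2)$ satisfies $g\cdot p_1=q_1$, $g\cdot p=q$, $g\cdot p_2=q_2$. The (2-point) Euclidean curvature is $\kappa=\frac{4\Delta}{abc}$, where $a,b,c$ are the Euclidean distances between the three points and $\Delta$ is the area of the triangle with vertices $p_1,p,p_2$. The mesh is in $SD$ (the signature-direction) if $p_1,p,p_2$ are in counterclockwise order on their circumcircle, and in $\sim SD$ otherwise.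
   Formalization: Side length d1 is taken positive; in part b) κ is assumed positive and some mesh with the data κ, d1, d2 is assumed to exist (proved equivalent to κ·d2 ≤ 2), since b) fails for κ = 0 (2 classes) and for κ·d2 > 2 (none). *)

(* Defs.v *)
From mathcomp Require Import all_boot all_order all_algebra.
From mathcomp Require Import all_classical all_reals all_analysis.
Set Implicit Arguments.
Unset Strict Implicit.
Unset Printing Implicit Defensive.
Import Order.TTheory GRing.Theory Num.Theory.
Local Open Scope classical_set_scope.
Local Open Scope ring_scope.

(* The norm that MathComp-Analysis puts on matrices is the sup norm, hence an
   explicit Euclidean distance. *)
Definition edist (R : realType) (x y : 'cV[R]_2) : R :=
  Num.sqrt (\sum_(i < 2) (x i 0 - y i 0) ^+ 2).

Definition triangle_area (R : realType) (x y z : 'cV[R]_2) : R :=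
  `| (y 0 0 - x 0 0) * (z 1 0 - x 1 0)
     - (z 0 0 - x 0 0) * (y 1 0 - x 1 0) | / 2.

Record mesh (R : realType) := Mesh {
  first_pt : 'cV[R]_2;
  mid_pt : 'cV[R]_2;
  last_pt : 'cV[R]_2;
  mesh_ordinary : first_pt != last_pt }.

Definition side1 (R : realType) (m : mesh R) : R :=
  edist (first_pt m) (mid_pt m).

Definition side2 (R : realType) (m : mesh R) : R :=
  edist (last_pt m) (mid_pt m).

Definition equally_spaced (R : realType) (m : mesh R) : Prop :=
  side1 m = side2 m.

(* If two of the three points coincide the denominator is zero and this is 0
   by the convention on division; the curvature is then undefined on paper. *)
Definition curvature (R : realType) (m : mesh R) : R :=
  4 * triangle_area (first_pt m) (mid_pt m) (last_pt m)
  / (edist (first_pt m) (mid_pt m) * edist (mid_pt m) (last_pt m)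
     * edist (first_pt m) (last_pt m)).

Definition SO2 (R : realType) : set 'M[R]_2 :=
  [set A | A *m A^T = 1%:M /\ \det A = 1].

Definition SE2_act (R : realType) (A : 'M[R]_2) (b x : 'cV[R]_2) : 'cV[R]_2 :=
  A *m x + b.

Definition congruent (R : realType) (m n : mesh R) : Prop :=
  exists (A : 'M[R]_2) (b : 'cV[R]_2),
    [/\ SO2 A,
        SE2_act A b (first_pt m) = first_pt n,
        SE2_act A b (mid_pt m) = mid_pt n
      & SE2_act A b (last_pt m) = last_pt n].

Definition congruence_class (R : realType) (m : mesh R) : set (mesh R) :=
  [set n | congruent m n].

Definition congruence_classes (R : realType) (S : set (mesh R)) :
  set (set (mesh R)) := (@congruence_class R) @` S.

Definition is_circumcircle (R : realType) (m : mesh R) (o : 'cV[R]_2) (r : R) :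
  Prop :=
  [/\ edist (first_pt m) o = r, edist (mid_pt m) o = r
    & edist (last_pt m) o = r].

Definition circle_pt (R : realType) (o : 'cV[R]_2) (r t : R) : 'cV[R]_2 :=
  o + \col_(i < 2) (if i == 0 then r * cos t else r * sin t).

(* Meshes in the signature-direction: travelling counterclockwise once around
   the circle from the first point, one meets the middle point and then the
   last point. *)
Definition SD (R : realType) : set (mesh R) :=
  [set m | exists (o : 'cV[R]_2) (r t1 t t2 : R),
     [/\ 0 < r, [/\ t1 < t, t < t2 & t2 < t1 + 2 * pi],
         first_pt m = circle_pt o r t1, mid_pt m = circle_pt o r t
       & last_pt m = circle_pt o r t2]].

Definition unequal_meshes (R : realType) (k d1 d2 : R) : set (mesh R) :=
  [set m | [/\ ~ equally_spaced m, curvature m = k, side1 m = d1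
             & side2 m = d2]].

(* Main.v *)
Require Import Defs.
From mathcomp Require Import all_boot all_order all_algebra.
From mathcomp Require Import all_classical all_reals all_analysis.
From mathcomp Require Import finmap ring lra.
Import Order.TTheory GRing.Theory Num.Theory.
Local Open Scope classical_set_scope.
Local Open Scope card_scope.
Local Open Scope ring_scope.

(** Up to an orientation preserving motion, a mesh with given side lengths
d1 and d2 is known once the angle at its middle point p is known, that is, once
the inner product c = (p1 - p).(p2 - p) and the cross product
s = (p - p1) x (p2 - p) are known.  These two numbers, the shape of the mesh,
satisfy c^2 + s^2 = (d1 d2)^2.  Conversely two meshes with the same d1 and the
same shape are carried onto each other by the rotation that aligns their first
sides ([congruent_of_invariants]).  So counting congruence classes amounts to
counting shapes ([classes_in_card]).

The area of the triangle is |s| / 2 and, by the law of cosines, the third side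
has square d1^2 + d2^2 - 2 c.  Hence having curvature k means that k >= 0 and
4 s^2 = (k d1 d2)^2 (d1^2 + d2^2 - 2 c).  Eliminating s leaves a quadratic
equation for c, with discriminant proportional to
(4 - (k d1)^2) (4 - (k d2)^2), and each root c determines s up to sign: there
are at most four shapes ([shapes_sub]).

For k > 0 the same two equations give
(4 - (k d2)^2) d1^2 (d1^2 + d2^2 - 2 c) = 4 (d1^2 - c)^2,
so k d2 <= 2 is necessary, and k d2 = 2 holds exactly when c = d1^2, that is
when the angle at p1 is right and the second side is a diameter of the
circumcircle ([curvature_side2], [circumcircle_side2]).  When k d2 <= 2 both
roots c satisfy |c| < d1 d2, so that s <> 0 and all the shapes are realised
([dot_root_lt], [shapesE]); the two roots coincide precisely when k d2 = 2.

A mesh is in the signature-direction exactly when s > 0: for points at angles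
t1 < t < t2 of a circle of radius r,
s = 4 r^2 sin ((t - t1) / 2) sin ((t2 - t) / 2) sin ((t2 - t1) / 2)
([turn_circle]).  Since every root c comes with the two values s and - s, half
of the classes lie in the signature-direction and half outside of it. *)

(** * Plane coordinates *)

(** Euclidean distance in the plane, whereas [edist] alone would be the
extended distance of pseudometric spaces. *)
Local Notation dist := Defs.edist.

Lemma ord2P (P : 'I_2 -> Prop) : P 0 -> P 1 -> forall i, P i.
Proof.
move=> P0 P1 [[|[|//]] lti].
  by rewrite (_ : Ordinal _ = 0) //; exact: val_inj.
by rewrite (_ : Ordinal _ = 1) //; exact: val_inj.
Qed.

Lemma cV2_eqP {R : realType} (u v : 'cV[R]_2) :
  u 0 0 = v 0 0 -> u 1 0 = v 1 0 -> u = v.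
Proof. by move=> h0 h1; apply/colP; exact: ord2P. Qed.

Lemma sum_ord2 {R : realType} (F : 'I_2 -> R) : \sum_(i < 2) F i = F 0 + F 1.
Proof.
by rewrite !big_ord_recl big_ord0 addr0; congr (_ + F _); exact: val_inj.
Qed.

Lemma dist_ge0 {R : realType} (x y : 'cV[R]_2) : 0 <= dist x y.
Proof. exact: sqrtr_ge0. Qed.

Lemma dist_sqr {R : realType} (x y : 'cV[R]_2) :
  dist x y ^+ 2 = (x 0 0 - y 0 0) ^+ 2 + (x 1 0 - y 1 0) ^+ 2.
Proof.
rewrite sqr_sqrtr; last by apply: sumr_ge0 => i _; exact: sqr_ge0.
exact: sum_ord2.
Qed.

Lemma distP {R : realType} (x y : 'cV[R]_2) (d : R) : 0 <= d ->
  dist x y = d <-> (x 0 0 - y 0 0) ^+ 2 + (x 1 0 - y 1 0) ^+ 2 = d ^+ 2.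
Proof.
move=> d_ge0; rewrite -dist_sqr; split=> [->//|/eqP].
by rewrite eqrXn2 ?dist_ge0 // => /eqP.
Qed.

Lemma dist_sym {R : realType} (x y : 'cV[R]_2) : dist x y = dist y x.
Proof. by apply/distP; rewrite ?dist_ge0 // dist_sqr; ring. Qed.

(** * The shape of a mesh *)

Definition dotp {R : realType} (m : mesh R) : R :=
  (first_pt m 0 0 - mid_pt m 0 0) * (last_pt m 0 0 - mid_pt m 0 0)
  + (first_pt m 1 0 - mid_pt m 1 0) * (last_pt m 1 0 - mid_pt m 1 0).

(** Twice the signed area of the triangle, positive when the path from the first
to the last point turns left at the middle point. *)
Definition turn {R : realType} (m : mesh R) : R :=
  (mid_pt m 0 0 - first_pt m 0 0) * (last_pt m 1 0 - mid_pt m 1 0)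
  - (mid_pt m 1 0 - first_pt m 1 0) * (last_pt m 0 0 - mid_pt m 0 0).

Definition shape {R : realType} (m : mesh R) : R * R := (dotp m, turn m).

(** Lagrange's identity for the two side vectors: the shape lies on a circle
of radius [side1 m * side2 m]. *)
Lemma lagrange {R : realType} (m : mesh R) :
  dotp m ^+ 2 + turn m ^+ 2 = (side1 m * side2 m) ^+ 2.
Proof. by rewrite exprMn !dist_sqr /dotp /turn; ring. Qed.

Lemma law_of_cosines {R : realType} (m : mesh R) :
  dist (first_pt m) (last_pt m) ^+ 2
  = side1 m ^+ 2 + side2 m ^+ 2 - 2 * dotp m.
Proof. by rewrite !dist_sqr /dotp; ring. Qed.

Lemma triangle_area_turn {R : realType} (m : mesh R) :
  triangle_area (first_pt m) (mid_pt m) (last_pt m) = `|turn m| / 2.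
Proof. by rewrite /triangle_area /turn; congr (`| _ | / 2); ring. Qed.

Lemma first_last_gt0 {R : realType} (m : mesh R) :
  0 < dist (first_pt m) (last_pt m).
Proof.
rewrite lt_neqAle dist_ge0 andbT eq_sym; apply/eqP => d0.
have /eqP := mesh_ordinary m; apply.
have := dist_sqr (first_pt m) (last_pt m).
rewrite d0 expr0n /= => /esym/eqP; rewrite paddr_eq0 ?sqr_ge0 //.
rewrite !sqrf_eq0 !subr_eq0 => /andP[/eqP ? /eqP ?].
exact: cV2_eqP.
Qed.

(** * Congruence and shape *)

Lemma det_2x2 {R : realType} (A : 'M[R]_2) :
  \det A = A 0 0 * A 1 1 - A 0 1 * A 1 0.
Proof.
rewrite (expand_det_row _ 0) sum_ord2 /cofactor !det_mx11 !mxE /=.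
rewrite expr0 expr1 mul1r mulN1r mulrN.
by congr (_ * A _ _ - _ * A _ _); exact: val_inj.
Qed.

(** With rows of norm 1 and determinant 1, the entries satisfy
(a00 - a11)^2 + (a01 + a10)^2 = 1 + 1 - 2 = 0. *)
Lemma rotation_coords {R : realType} (A : 'M[R]_2) : SO2 A ->
  [/\ A 1 1 = A 0 0, A 0 1 = - A 1 0 & A 0 0 ^+ 2 + A 1 0 ^+ 2 = 1].
Proof.
move=> [orthA detA].
have entry i j : A i 0 * A j 0 + A i 1 * A j 1 = (i == j)%:R.
  have := congr1 (fun M : 'M[R]_2 => M i j) orthA.
  by rewrite !mxE sum_ord2 !mxE.
have e00 : A 0 0 * A 0 0 + A 0 1 * A 0 1 = 1 := entry 0 0.
have e11 : A 1 0 * A 1 0 + A 1 1 * A 1 1 = 1 := entry 1 1.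
rewrite det_2x2 in detA.
have : (A 0 0 - A 1 1) ^+ 2 + (A 0 1 + A 1 0) ^+ 2 = 0 by lra.
move/eqP; rewrite paddr_eq0 ?sqr_ge0 //.
rewrite !sqrf_eq0 subr_eq0 addr_eq0 => /andP[/eqP a11 /eqP a01].
by split=> //; rewrite -e00 a01; ring.
Qed.

Lemma SE2_actE {R : realType} (A : 'M[R]_2) (b x : 'cV[R]_2) i :
  SE2_act A b x i 0 = A i 0 * x 0 0 + A i 1 * x 1 0 + b i 0.
Proof. by rewrite !mxE sum_ord2. Qed.

Lemma SE2_act_centered {R : realType} (A : 'M[R]_2) (p q z : 'cV[R]_2) i :
  SE2_act A (q - A *m p) z i 0
  = A i 0 * (z 0 0 - p 0 0) + A i 1 * (z 1 0 - p 1 0) + q i 0.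
Proof. by rewrite SE2_actE !mxE sum_ord2; ring. Qed.

Lemma congruent_invariants {R : realType} (m n : mesh R) : congruent m n ->
  [/\ side1 m = side1 n, side2 m = side2 n & shape m = shape n].
Proof.
move=> [A [b [/rotation_coords[a11 a01 a1] f1 f f2]]].
have isom x y : dist (SE2_act A b x) (SE2_act A b y) = dist x y.
  apply/distP; rewrite ?dist_ge0 // dist_sqr !SE2_actE a11 a01.
  rewrite -[RHS]mul1r -a1; ring.
rewrite /side1 /side2 /shape /dotp /turn -f1 -f -f2 !isom; split=> //.
rewrite !SE2_actE a11 a01.
congr pair; rewrite -[LHS]mul1r -a1; ring.
Qed.

(** In complex notation, with u and u' the first side vectors of [m] and [n],
the motion is the rotation by u' / u that sends the middle point of [m] to that
of [n].  It sends the other side vector v of [m] to the vector that has the same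
inner and cross products with u' as v has with u, so to the one of [n]. *)
Lemma congruent_of_invariants {R : realType} (m n : mesh R) : 0 < side1 m ->
  side1 m = side1 n -> shape m = shape n -> congruent m n.
Proof.
move=> side1_gt0 eq_side1 [eq_dot eq_turn].
have D_neq0 : side1 m ^+ 2 != 0 by rewrite sqrf_eq0 gt_eqF.
move: eq_side1 => /(congr1 (fun d => d ^+ 2)).
rewrite !dist_sqr; move: D_neq0; rewrite !dist_sqr.
move: eq_dot eq_turn; rewrite /dotp /turn.
set x1 := first_pt m 0 0; set y1 := first_pt m 1 0.
set x := mid_pt m 0 0; set y := mid_pt m 1 0.
set x2 := last_pt m 0 0; set y2 := last_pt m 1 0.
set x1' := first_pt n 0 0; set y1' := first_pt n 1 0.
set x' := mid_pt n 0 0; set y' := mid_pt n 1 0.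
set x2' := last_pt n 0 0; set y2' := last_pt n 1 0.
set D := (x1 - x) ^+ 2 + (y1 - y) ^+ 2.
move=> eq_dot eq_turn D_neq0 eqD.
(* a + i b is the quotient u' / u. *)
pose a := ((x1 - x) * (x1' - x') + (y1 - y) * (y1' - y')) / D.
pose b := ((x1 - x) * (y1' - y') - (y1 - y) * (x1' - x')) / D.
have ab1 : a ^+ 2 + b ^+ 2 = 1.
  have -> : a ^+ 2 + b ^+ 2 = D * ((x1' - x') ^+ 2 + (y1' - y') ^+ 2) / D ^+ 2.
    by rewrite /a /b; move: D_neq0; rewrite /D => D_neq0; field.
  by rewrite -eqD; field.
pose A : 'M[R]_2 := \matrix_(i, j)
  if i == j then a else if i == 0 then - b else b.
have [A00 A01] : A 0 0 = a /\ A 0 1 = - b by rewrite !mxE.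
have [A10 A11] : A 1 0 = b /\ A 1 1 = a by rewrite !mxE.
have D_neq0' : (x1' - x') ^+ 2 + (y1' - y') ^+ 2 != 0 by rewrite -eqD.
have u0 : a * (x1 - x) - b * (y1 - y) = x1' - x'.
  by rewrite /a /b; move: D_neq0; rewrite /D => D_neq0; field.
have u1 : b * (x1 - x) + a * (y1 - y) = y1' - y'.
  by rewrite /a /b; move: D_neq0; rewrite /D => D_neq0; field.
have v0 : a * (x2 - x) - b * (y2 - y) = x2' - x'.
  transitivity ((((x1 - x) * (x2 - x) + (y1 - y) * (y2 - y)) * (x1' - x')
    + ((x - x1) * (y2 - y) - (y - y1) * (x2 - x)) * (y1' - y')) / D).
    by rewrite /a /b; field.
  by rewrite eq_dot eq_turn eqD; field.
have v1 : b * (x2 - x) + a * (y2 - y) = y2' - y'.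
  transitivity ((((x1 - x) * (x2 - x) + (y1 - y) * (y2 - y)) * (y1' - y')
    - ((x - x1) * (y2 - y) - (y - y1) * (x2 - x)) * (x1' - x')) / D).
    by rewrite /a /b; field.
  by rewrite eq_dot eq_turn eqD; field.
exists A, (mid_pt n - A *m mid_pt m); split.
- split; last by rewrite det_2x2 A00 A01 A10 A11 -ab1; ring.
  clearbody A; apply/matrixP; apply: ord2P; apply: ord2P;
  rewrite !mxE sum_ord2 !mxE ?A00 ?A01 ?A10 ?A11 /= -?ab1; ring.
- by apply: cV2_eqP; rewrite SE2_act_centered ?A00 ?A01 ?A10 ?A11 ?mulNr
    ?u0 ?u1 subrK.
- by apply: cV2_eqP; rewrite SE2_act_centered !subrr !mulr0 !add0r.
- by apply: cV2_eqP; rewrite SE2_act_centered ?A00 ?A01 ?A10 ?A11 ?mulNr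
    ?v0 ?v1 subrK.
Qed.

(** * Shapes of given curvature *)

(** Squaring k L = 2 |s|, with L the product of the three sides, loses only
the sign of k. *)
Lemma curvature_eqP {R : realType} (m : mesh R) (k : R) :
    0 < side1 m -> 0 < side2 m ->
  curvature m = k <-> 0 <= k /\ 4 * turn m ^+ 2
    = (k * (side1 m * side2 m)) ^+ 2
      * (side1 m ^+ 2 + side2 m ^+ 2 - 2 * dotp m).
Proof.
move=> side1_gt0 side2_gt0.
have gap_gt0 := first_last_gt0 m.
pose L := side1 m * side2 m * dist (first_pt m) (last_pt m).
have L_gt0 : 0 < L by rewrite !mulr_gt0.
have curvE : curvature m = 2 * `|turn m| / L.
  rewrite /curvature triangle_area_turn (dist_sym (mid_pt m)) -/(side1 m).
  by rewrite -/(side2 m) -/L; congr (_ / _); field.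
rewrite curvE -law_of_cosines -exprMn -(mulrA k) -/L.
have -> : 4 * turn m ^+ 2 = (2 * `|turn m|) ^+ 2.
  by rewrite exprMn real_normK ?num_real //; ring.
split=> [<-|[k_ge0 /eqP]].
  by rewrite divfK ?gt_eqF // divr_ge0 ?mulr_ge0 // ltW.
rewrite eqrXn2 ?(mulr_ge0 _ (ltW L_gt0)) ?mulr_ge0 // => /eqP ->.
by rewrite mulfK ?gt_eqF.
Qed.

Definition shapes {R : realType} (k d1 d2 : R) : set (R * R) :=
  [set cs | [/\ 0 <= k, cs.1 ^+ 2 + cs.2 ^+ 2 = (d1 * d2) ^+ 2
    & 4 * cs.2 ^+ 2
      = (k * (d1 * d2)) ^+ 2 * (d1 ^+ 2 + d2 ^+ 2 - 2 * cs.1)]].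

Lemma shape_in_shapes {R : realType} (k d1 d2 : R) (m : mesh R) :
  0 < d1 -> 0 < d2 -> unequal_meshes k d1 d2 m -> shapes k d1 d2 (shape m).
Proof.
move=> d1_gt0 d2_gt0 [_ curv s1 s2].
have [|||k_ge0 turn_sqr] := (curvature_eqP m k _ _).1; rewrite ?s1 ?s2 //.
by split=> //=; rewrite ?lagrange -?s1 -?s2.
Qed.

(** The witness has its middle point at the origin and its first point on the
first axis.  It is ordinary because d1 <> d2: if the first and last points were
equal, then the circle c^2 + s^2 = (d1 d2)^2 would force d1 = d2. *)
Lemma shape_realized {R : realType} (k d1 d2 : R) (cs : R * R) :
    0 < d1 -> d1 < d2 -> shapes k d1 d2 cs ->
  exists2 m : mesh R, unequal_meshes k d1 d2 m & shape m = cs.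
Proof.
move=> d1_gt0 d12; case: cs => c s [/= k_ge0 cs_norm s_sqr].
have d2_gt0 : 0 < d2 by exact: lt_trans d12.
pose p1 : 'cV[R]_2 := \col_i (if i == 0 then d1 else 0).
pose p2 : 'cV[R]_2 := \col_i (if i == 0 then c / d1 else - s / d1).
have d1_neq0 : d1 != 0 by rewrite gt_eqF.
have p12 : p1 != p2.
  apply/eqP => eq_p12.
  have := congr1 (fun p : 'cV[R]_2 => p 0 0) eq_p12; rewrite !mxE /= => c_eq.
  have := congr1 (fun p : 'cV[R]_2 => p 1 0) eq_p12; rewrite !mxE /= => s_eq.
  have c_d1 : c = d1 ^+ 2 by rewrite expr2 {1}c_eq divfK.
  have s_0 : s = 0.
    by move/esym/eqP: s_eq; rewrite mulf_eq0 invr_eq0 (negPf d1_neq0) orbF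
      oppr_eq0 => /eqP.
  move/eqP: cs_norm; rewrite c_d1 s_0 expr0n addr0 /= eqrXn2 //; last first.
  - by rewrite mulr_ge0 ?ltW.
  - by rewrite sqr_ge0.
  by rewrite expr2 (inj_eq (mulfI d1_neq0)) lt_eqF.
pose m := Mesh 0 p12.
have dotm : dotp m = c by rewrite /dotp /= !mxE /=; field.
have turnm : turn m = s by rewrite /turn /= !mxE /=; field.
have s1 : side1 m = d1.
  by apply/distP; rewrite ?(ltW d1_gt0) // !mxE /=; ring.
have s2 : side2 m = d2.
  apply/distP; first exact: ltW.
  rewrite !mxE /= -[RHS](mulfK (expf_neq0 2 d1_neq0)) -exprMn
    (mulrC d2) -cs_norm.
  by field.
exists m; last by rewrite /shape dotm turnm.
split=> //; first by rewrite /equally_spaced s1 s2; apply/eqP; rewrite lt_eqF.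
by apply/curvature_eqP; rewrite ?s1 ?s2 // turnm dotm.
Qed.

(** The root, for e = 1 or e = -1, of the quadratic equation for the inner
product c.  Setting sin a = k d1 / 2 and sin b = k d2 / 2, as the law of sines
suggests, it is d1 d2 (sin a sin b + e cos a cos b). *)
Definition dot_root {R : realType} (k d1 d2 e : R) : R :=
  d1 * d2 * (k ^+ 2 * (d1 * d2)
    + e * Num.sqrt ((4 - (k * d1) ^+ 2) * (4 - (k * d2) ^+ 2))) / 4.

Definition turn_root {R : realType} (k d1 d2 e : R) : R :=
  Num.sqrt ((d1 * d2) ^+ 2 - dot_root k d1 d2 e ^+ 2).

Definition ccw_shapes {R : realType} (k d1 d2 : R) : seq (R * R) :=
  [seq (dot_root k d1 d2 e, turn_root k d1 d2 e) | e <- [:: 1; -1]].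

Definition cw_shapes {R : realType} (k d1 d2 : R) : seq (R * R) :=
  [seq (dot_root k d1 d2 e, - turn_root k d1 d2 e) | e <- [:: 1; -1]].

(** Completing the square, ((4 c - (k d1 d2)^2) / (d1 d2))^2 is the quantity
under the square root in [dot_root], so e is the sign of the left-hand base. *)
Lemma shapes_sub {R : realType} (k d1 d2 : R) : 0 < d1 -> 0 < d2 ->
  shapes k d1 d2 `<=` [set` ccw_shapes k d1 d2 ++ cw_shapes k d1 d2].
Proof.
move=> d1_gt0 d2_gt0 [c s] [/= k_ge0 cs_norm s_sqr].
set D := (4 - (k * d1) ^+ 2) * (4 - (k * d2) ^+ 2).
have P_gt0 : 0 < d1 * d2 by rewrite mulr_gt0.
have quad : ((4 * c - (k * (d1 * d2)) ^+ 2) / (d1 * d2)) ^+ 2 = D.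
  suff -> : D = (4 * c - (k * (d1 * d2)) ^+ 2) ^+ 2 / (d1 * d2) ^+ 2.
    by rewrite expr_div_n.
  have -> : (4 * c - (k * (d1 * d2)) ^+ 2) ^+ 2 = (d1 * d2) ^+ 2 * D.
    have s2E : s ^+ 2 = (d1 * d2) ^+ 2 - c ^+ 2 by rewrite -cs_norm; ring.
    move: s_sqr; rewrite s2E /D => eq_c.
    by lra.
  by rewrite mulrAC mulfV ?mul1r // expf_neq0 // gt_eqF.
have sqrtD : Num.sqrt D = `|(4 * c - (k * (d1 * d2)) ^+ 2) / (d1 * d2)|.
  by rewrite -quad sqrtr_sqr.
have [e e_pm c_e] : exists2 e, e \in [:: 1; -1] & c = dot_root k d1 d2 e.
  have [neg|pos] := ltP ((4 * c - (k * (d1 * d2)) ^+ 2) / (d1 * d2)) 0.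
    exists (-1); first by rewrite !inE eqxx orbT.
    rewrite /dot_root -/D sqrtD ltr0_norm //; move: P_gt0 => /lt0r_neq0.
    by rewrite mulf_eq0 => /norP[? ?]; field; apply/andP.
  exists 1; first by rewrite !inE eqxx.
  rewrite /dot_root -/D sqrtD ger0_norm //; move: P_gt0 => /lt0r_neq0.
  by rewrite mulf_eq0 => /norP[? ?]; field; apply/andP.
have s_e : `|s| = turn_root k d1 d2 e.
  by rewrite /turn_root -c_e -cs_norm addrAC subrr add0r sqrtr_sqr.
suff : (c, s) \in ccw_shapes k d1 d2 ++ cw_shapes k d1 d2 by [].
rewrite mem_cat; apply/orP.
have [neg|pos] := ltP s 0; [right|left]; apply/mapP; exists e => //.
  by rewrite -s_e -c_e ltr0_norm // opprK.
by rewrite -s_e -c_e ger0_norm.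
Qed.

(** Each root gives an actual angle at the middle point, which is not flat.
The bound c <= d1 d2 comes from
(4 - x^2) (4 - y^2) = (4 - x y)^2 - 4 (x - y)^2 with x = k d1 and y = k d2.
Then d1^2 + d2^2 - 2 c >= (d2 - d1)^2 > 0, and the equation makes
(d1 d2)^2 - c^2 positive. *)
Lemma dot_root_lt {R : realType} (k d1 d2 e : R) :
    0 < d1 -> d1 < d2 -> 0 < k -> k * d2 <= 2 -> e \in [:: 1; -1] ->
  `|dot_root k d1 d2 e| < d1 * d2 /\
  4 * ((d1 * d2) ^+ 2 - dot_root k d1 d2 e ^+ 2)
    = (k * (d1 * d2)) ^+ 2 * (d1 ^+ 2 + d2 ^+ 2 - 2 * dot_root k d1 d2 e).
Proof.
move=> d1_gt0 d12 k_gt0 kd2 e_pm.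
have d2_gt0 : 0 < d2 by exact: lt_trans d12.
have P_gt0 : 0 < d1 * d2 by rewrite mulr_gt0.
have kd1 : k * d1 <= 2 by rewrite (le_trans _ kd2) // ler_pM2l // ltW.
have [kd1_gt0 kd2_gt0] : 0 < k * d1 /\ 0 < k * d2 by rewrite !mulr_gt0.
set c := dot_root _ _ _ _.
pose D := (4 - (k * d1) ^+ 2) * (4 - (k * d2) ^+ 2).
have D_ge0 : 0 <= D by apply: mulr_ge0; nra.
have e_sqr : e ^+ 2 = 1.
  by move: e_pm; rewrite !inE => /orP[] /eqP ->; ring.
have quad : 4 * ((d1 * d2) ^+ 2 - c ^+ 2)
    = (k * (d1 * d2)) ^+ 2 * (d1 ^+ 2 + d2 ^+ 2 - 2 * c).
  have D_sqr : (e * Num.sqrt D) ^+ 2 = D.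
    by rewrite exprMn e_sqr mul1r sqr_sqrtr.
  have cE : 4 * c - (k * (d1 * d2)) ^+ 2 = d1 * d2 * (e * Num.sqrt D).
    by rewrite /c /dot_root -/D; field.
  have : (4 * c - (k * (d1 * d2)) ^+ 2) ^+ 2 = (d1 * d2) ^+ 2 * D.
    by rewrite cE exprMn D_sqr.
  by rewrite /D => eq_c; nra.
have sqrtD_le : Num.sqrt D <= 4 - k * d1 * (k * d2).
  have amgm : 0 <= 4 - k * d1 * (k * d2) by nra.
  rewrite -(ger0_norm amgm) -sqrtr_sqr ler_wsqrtr // /D.
  have := sqr_ge0 (k * d1 - k * d2); nra.
have c_le : c <= d1 * d2.
  have eD : e * Num.sqrt D <= 4 - k * d1 * (k * d2).
    have := sqrtr_ge0 D.
    by move: e_pm; rewrite !inE => /orP[] /eqP ->; lra.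
  rewrite /c /dot_root -/D; nra.
split=> //.
have gap : 0 < d1 ^+ 2 + d2 ^+ 2 - 2 * c.
  have : 0 < (d2 - d1) ^+ 2 by rewrite exprn_gt0 // subr_gt0.
  nra.
have : 0 < (d1 * d2) ^+ 2 - c ^+ 2.
  have : 0 < 4 * ((d1 * d2) ^+ 2 - c ^+ 2).
    by rewrite quad mulr_gt0 // exprn_gt0 // mulr_gt0.
  lra.
rewrite subr_gt0 -(real_normK (num_real c)) ltr_pXn2r // nnegrE ?ltW //.
Qed.

Lemma turn_root_gt0 {R : realType} (k d1 d2 e : R) :
    0 < d1 -> d1 < d2 -> 0 < k -> k * d2 <= 2 -> e \in [:: 1; -1] ->
  0 < turn_root k d1 d2 e.
Proof.
move=> d1_gt0 d12 k_gt0 kd2 e_pm.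
have [c_lt _] := dot_root_lt _ _ _ _ d1_gt0 d12 k_gt0 kd2 e_pm.
rewrite sqrtr_gt0 subr_gt0 -(real_normK (num_real (dot_root _ _ _ _))).
have P_ge0 : 0 <= d1 * d2 by rewrite mulr_ge0 ?ltW // (lt_trans d1_gt0).
by rewrite ltr_pXn2r // nnegrE.
Qed.

Lemma shapesE {R : realType} (k d1 d2 : R) :
    0 < d1 -> d1 < d2 -> 0 < k -> k * d2 <= 2 ->
  shapes k d1 d2 = [set` ccw_shapes k d1 d2 ++ cw_shapes k d1 d2].
Proof.
move=> d1_gt0 d12 k_gt0 kd2.
apply/seteqP; split; first exact: shapes_sub (lt_trans d1_gt0 d12).
move=> cs in_cs.
have {in_cs} : cs \in ccw_shapes k d1 d2 ++ cw_shapes k d1 d2 by [].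
have root_shape e s : e \in [:: 1; -1] -> s ^+ 2 = turn_root k d1 d2 e ^+ 2 ->
    shapes k d1 d2 (dot_root k d1 d2 e, s).
  move=> e_pm s_sqr.
  have [_ quad] := dot_root_lt _ _ _ _ d1_gt0 d12 k_gt0 kd2 e_pm.
  have turn_gt0 := turn_root_gt0 _ _ _ _ d1_gt0 d12 k_gt0 kd2 e_pm.
  have s2E : s ^+ 2 = (d1 * d2) ^+ 2 - dot_root k d1 d2 e ^+ 2.
    by rewrite s_sqr sqr_sqrtr // ltW // -sqrtr_gt0.
  by split=> /=; rewrite ?s2E ?quad ?(ltW k_gt0) //; ring.
rewrite mem_cat => /orP[] /mapP[e e_pm ->]; apply: root_shape => //.
by rewrite sqrrN.
Qed.

(** Since k d1 < k d2 <= 2, the quantity under the square root can only vanish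
through its factor 4 - (k d2)^2. *)
Lemma dot_root_eq {R : realType} (k d1 d2 : R) :
    0 < d1 -> d1 < d2 -> 0 < k -> k * d2 <= 2 ->
  (dot_root k d1 d2 1 == dot_root k d1 d2 (-1)) = (k * d2 == 2).
Proof.
move=> d1_gt0 d12 k_gt0 kd2.
have d2_gt0 : 0 < d2 by exact: lt_trans d12.
have kd1_lt : k * d1 < 2 by rewrite (lt_le_trans _ kd2) // ltr_pM2l.
have kd1_gt0 : 0 < k * d1 by rewrite mulr_gt0.
have kd2_gt0 : 0 < k * d2 by rewrite mulr_gt0.
have P_neq0 : d1 * d2 != 0 by rewrite gt_eqF ?mulr_gt0.
rewrite -subr_eq0 /dot_root.
set D := (4 - _) * (4 - _).
have -> : d1 * d2 * (k ^+ 2 * (d1 * d2) + 1 * Num.sqrt D) / 4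
    - d1 * d2 * (k ^+ 2 * (d1 * d2) + -1 * Num.sqrt D) / 4
    = d1 * d2 * Num.sqrt D / 2 by field.
rewrite mulf_eq0 invr_eq0 pnatr_eq0 orbF mulf_eq0 (negPf P_neq0) /= sqrtr_eq0.
apply/idP/eqP => [D_le0|kd2_eq]; last by rewrite /D kd2_eq; lra.
apply/eqP; move: kd2; rewrite le_eqVlt => /orP[//|kd2_lt].
suff : 0 < D by rewrite ltNge D_le0.
by rewrite mulr_gt0; nra.
Qed.

(** * Counting the shapes *)

Lemma card_set_seq {T : choiceType} (s : seq T) :
  [set` s] #= `I_(size (undup s)).
Proof.
have -> : [set` s] = [set` [fset x in s]%fset].
  by apply/seteqP; split=> x /=; rewrite inE.
by apply/card_eq_fsetP; rewrite card_fseq.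
Qed.

Lemma size_undup_shapes {R : realType} (k d1 d2 : R) :
    0 < d1 -> d1 < d2 -> 0 < k -> k * d2 <= 2 ->
  let n := if k * d2 == 2 then 1%N else 2%N in
  [/\ size (undup (ccw_shapes k d1 d2)) = n,
      size (undup (cw_shapes k d1 d2)) = n
    & size (undup (ccw_shapes k d1 d2 ++ cw_shapes k d1 d2)) = n.*2].
Proof.
move=> d1_gt0 d12 k_gt0 kd2.
have pos e := turn_root_gt0 _ _ _ e d1_gt0 d12 k_gt0 kd2.
have {pos} [] : 0 < turn_root k d1 d2 1 /\ 0 < turn_root k d1 d2 (-1).
  by split; apply: pos; rewrite !inE eqxx ?orbT.
have := dot_root_eq _ _ _ d1_gt0 d12 k_gt0 kd2.
rewrite /ccw_shapes /cw_shapes /= !inE !xpair_eqE /turn_root.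
move: (dot_root _ _ _ 1) (dot_root _ _ _ (-1)) => c1 c2 <-.
have [-> s_gt0 _|c12 s1_gt0 s2_gt0] := eqVneq c1 c2; rewrite !eqxx /=.
  have /negPf -> : Num.sqrt ((d1 * d2) ^+ 2 - c2 ^+ 2)
      != - Num.sqrt ((d1 * d2) ^+ 2 - c2 ^+ 2).
    by apply/eqP; lra.
  by rewrite /=.
have /negPf -> : Num.sqrt ((d1 * d2) ^+ 2 - c1 ^+ 2)
    != - Num.sqrt ((d1 * d2) ^+ 2 - c1 ^+ 2).
  by apply/eqP; lra.
have /negPf -> : Num.sqrt ((d1 * d2) ^+ 2 - c2 ^+ 2)
    != - Num.sqrt ((d1 * d2) ^+ 2 - c2 ^+ 2).
  by apply/eqP; lra.
by rewrite ?(eq_sym c2) ?(negPf c12) /=.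
Qed.

(** * From shapes to congruence classes *)

Definition mesh_class {R : realType} (d1 d2 : R) (cs : R * R) : set (mesh R) :=
  [set n | [/\ side1 n = d1, side2 n = d2 & shape n = cs]].

Lemma congruence_classE {R : realType} (m : mesh R) :
  0 < side1 m -> 0 < side2 m ->
  congruence_class m = mesh_class (side1 m) (side2 m) (shape m).
Proof.
move=> s1 s2; apply/seteqP; split=> n /=.
  by case/congruent_invariants => -> -> ->.
by case=> e1 _ e3; exact: congruent_of_invariants.
Qed.

Lemma unequal_meshes_class {R : realType} (k d1 d2 : R) (m n : mesh R) :
    0 < d1 -> d1 < d2 -> unequal_meshes k d1 d2 m ->
  mesh_class d1 d2 (shape m) n -> unequal_meshes k d1 d2 n.
Proof.
move=> d1_gt0 d12 [neq curv s1 s2] [s1' s2' [dotE turnE]].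
have d2_gt0 : 0 < d2 by exact: lt_trans d12.
split=> //; first by rewrite /equally_spaced s1' s2' -s1 -s2.
apply/curvature_eqP; rewrite ?s1' ?s2' // dotE turnE -s1 -s2.
by apply/curvature_eqP; rewrite ?s1 ?s2.
Qed.

(** Any property [D] of meshes that depends only on the shape may be imposed on
whole classes; taking the class of a shape is injective on the shapes that are
realised, because a realising mesh belongs to its class. *)
Lemma classes_in_card {R : realType} (k d1 d2 : R) (D : set (mesh R))
    (P : set (R * R)) : 0 < d1 -> d1 < d2 ->
    (forall m, unequal_meshes k d1 d2 m -> D m <-> P (shape m)) ->
  [set C | congruence_classes (unequal_meshes k d1 d2) C /\ C `<=` D]
    #= shapes k d1 d2 `&` P.
Proof.
move=> d1_gt0 d12 DP.
have d2_gt0 : 0 < d2 by exact: lt_trans d12.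
have classE m : unequal_meshes k d1 d2 m ->
    congruence_class m = mesh_class d1 d2 (shape m).
  by move=> [_ _ s1 s2]; rewrite congruence_classE ?s1 ?s2.
have -> : [set C | congruence_classes (unequal_meshes k d1 d2) C /\ C `<=` D]
    = mesh_class d1 d2 @` (shapes k d1 d2 `&` P).
  apply/seteqP; split=> [C [[m m_in <-] CD]|C [cs [cs_in Pcs] <-]] /=.
    exists (shape m); last by rewrite classE.
    split; first exact: shape_in_shapes.
    apply/(DP _ m_in)/CD; rewrite classE //.
    by case: m_in.
  have [m m_in m_cs] := shape_realized _ _ _ _ d1_gt0 d12 cs_in; split.
    by exists m => //; rewrite classE // m_cs.
  rewrite -m_cs => n nC.
  have n_in := unequal_meshes_class _ _ _ _ _ d1_gt0 d12 m_in nC.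
  by apply/(DP _ n_in); case: nC => _ _ ->; rewrite m_cs.
apply: inj_card_eq => cs cs' /set_mem[cs_in _] _ eq_class.
have [m [_ _ s1 s2] m_cs] := shape_realized _ _ _ _ d1_gt0 d12 cs_in.
have : mesh_class d1 d2 cs m by split.
by rewrite eq_class -m_cs => -[].
Qed.

Lemma classes_card {R : realType} (k d1 d2 : R) : 0 < d1 -> d1 < d2 ->
  congruence_classes (unequal_meshes k d1 d2) #= shapes k d1 d2.
Proof.
move=> d1_gt0 d12; rewrite -[X in _ #= X]setIT.
have := classes_in_card k d1 d2 setT setT d1_gt0 d12 (fun _ _ => conj id id).
suff -> : [set C | congruence_classes (unequal_meshes k d1 d2) C
    /\ C `<=` [set: mesh R]] = congruence_classes (unequal_meshes k d1 d2)
  by [].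
by apply/seteqP; split=> [C []|C CC] //=; split.
Qed.

(** * The signature-direction *)

(** With t - t1 = 2 a and t2 - t = 2 b the cross product is
r^2 (sin 2a + sin 2b - sin (2a + 2b)). *)
Lemma turn_circle {R : realType} (m : mesh R) (o : 'cV[R]_2) (r t1 t t2 : R) :
    first_pt m = circle_pt o r t1 -> mid_pt m = circle_pt o r t ->
    last_pt m = circle_pt o r t2 ->
  turn m = 4 * r ^+ 2 * sin ((t - t1) / 2) * sin ((t2 - t) / 2)
    * sin ((t2 - t1) / 2).
Proof.
move=> e1 e e2; rewrite /turn e1 e e2 !mxE /=.
pose a := (t - t1) / 2; pose b := (t2 - t) / 2.
have -> : (t2 - t1) / 2 = a + b by rewrite /a /b; field.
have -> : t1 = t - (a + a) by rewrite /a; field.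
have -> : t2 = t + (b + b) by rewrite /b; field.
have -> : (t - (t - (a + a))) / 2 = a by field.
have -> : (t + (b + b) - t) / 2 = b by field.
rewrite !(cosB, sinB, cosD, sinD).
have := cos2Dsin2 a; have := cos2Dsin2 b; have := cos2Dsin2 t.
move: (cos a) (sin a) (cos b) (sin b) (cos t) (sin t) => ca sa cb sb ct st.
move=> /(canRL (addKr _)) ht /(canRL (addKr _)) hb /(canRL (addKr _)) ha.
ring: ht hb ha.
Qed.

Lemma SD_turn_gt0 {R : realType} (m : mesh R) : SD m -> 0 < turn m.
Proof.
move=> [ctr [r [t1 [t [t2 [r_gt0 [t1t tt2 t2t1] e1 e e2]]]]]].
rewrite (turn_circle _ _ _ _ _ _ e1 e e2).
have sin_pos x : 0 < x -> x < 2 * pi -> 0 < sin (x / 2).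
  by move=> x0 x2pi; apply: sin_gt0_pi; apply/andP; split; lra.
by rewrite !mulr_gt0 ?exprn_gt0 ?sin_pos //; lra.
Qed.

Lemma angle_exists {R : realType} (x y : R) : x ^+ 2 + y ^+ 2 = 1 ->
  exists t, [/\ 0 <= t, t < 2 * pi, cos t = x & sin t = y].
Proof.
move=> xy1.
have x_in : -1 <= x <= 1 by apply/andP; split; nra.
have cosx : cos (acos x) = x by apply: acosK; rewrite in_itv.
have sinx : sin (acos x) = `|y|.
  by rewrite sin_acos // -xy1 addrAC subrr add0r sqrtr_sqr.
have acos_ge := acos_ge0 x_in; have acos_le := acos_lepi x_in.
have pi_gt := @pi_gt0 R.
have [y_ge0|y_lt0] := leP 0 y.
  by exists (acos x); split=> //; [lra | rewrite sinx ger0_norm].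
exists (2 * pi - acos x).
have acos_gt0 : 0 < acos x.
  rewrite lt_neqAle acos_ge andbT; apply/eqP => ac0.
  by move: sinx; rewrite -ac0 sin0 => /esym/eqP; rewrite normr_eq0 lt_eqF.
have -> : 2 * pi - acos x = - acos x + pi *+ 2 :> R by rewrite mulr2n; ring.
rewrite cosD2pi sinD2pi cosN sinN cosx sinx ltr0_norm // opprK.
by split=> //; rewrite mulr2n; lra.
Qed.

(** The window of angles may start at any t0: turn the picture back by t0 and
take an angle that is at least 0 and less than 2 pi. *)
Lemma circle_pt_exists {R : realType} (p o : 'cV[R]_2) (r t0 : R) : 0 < r ->
  dist p o = r -> exists t, [/\ t0 <= t, t < t0 + 2 * pi & p = circle_pt o r t].
Proof.
move=> r_gt0 /distP -/(_ (ltW r_gt0)) p_on.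
have r_neq0 : r != 0 by rewrite gt_eqF.
set x := p 0 0 - o 0 0 in p_on; set y := p 1 0 - o 1 0 in p_on.
have ct0 := cos2Dsin2 t0.
have [|th [th_ge0 th_lt c_th s_th]] :=
  angle_exists ((x * cos t0 + y * sin t0) / r) ((y * cos t0 - x * sin t0) / r).
  transitivity ((x ^+ 2 + y ^+ 2) * (cos t0 ^+ 2 + sin t0 ^+ 2) / r ^+ 2).
    by field.
  by rewrite ct0 p_on; field.
exists (t0 + th); split; [lra | lra |].
apply: cV2_eqP; rewrite !mxE /= ?cosD ?sinD c_th s_th.
  transitivity (o 0 0 + x * (cos t0 ^+ 2 + sin t0 ^+ 2)); last by field.
  by rewrite ct0 /x; ring.
transitivity (o 1 0 + y * (cos t0 ^+ 2 + sin t0 ^+ 2)); last by field.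
by rewrite ct0 /y; ring.
Qed.

(** With the middle point as origin, the centre o solves 2 o.u = |u|^2 and
2 o.v = |v|^2 for the side vectors u and v; Cramer's rule applies because the
determinant of the system is, up to sign, [turn m]. *)
Lemma circumcircle_exists {R : realType} (m : mesh R) : turn m != 0 ->
  exists (o : 'cV[R]_2) (r : R), is_circumcircle m o r.
Proof.
rewrite /turn => turn_neq0.
set x1 := first_pt m 0 0 in turn_neq0; set y1 := first_pt m 1 0 in turn_neq0.
set x := mid_pt m 0 0 in turn_neq0; set y := mid_pt m 1 0 in turn_neq0.
set x2 := last_pt m 0 0 in turn_neq0; set y2 := last_pt m 1 0 in turn_neq0.
pose u := (x1 - x) ^+ 2 + (y1 - y) ^+ 2.
pose v := (x2 - x) ^+ 2 + (y2 - y) ^+ 2.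
pose S := (x - x1) * (y2 - y) - (y - y1) * (x2 - x).
pose a := (v * (y1 - y) - u * (y2 - y)) / (2 * S).
pose b := (u * (x2 - x) - v * (x1 - x)) / (2 * S).
pose o : 'cV[R]_2 := \col_i (if i == 0 then x + a else y + b).
exists o, (dist (mid_pt m) o).
by split=> //; apply/distP; rewrite ?dist_ge0 // dist_sqr !mxE /=
  -/x -/y -/x1 -/y1 -/x2 -/y2 /a /b /u /v /S; field.
Qed.

(** Take the angles t and t2 of the other points at least t1 and less than
t1 + 2 pi.  If t2 <= t, then the product of sines in [turn_circle] has a
middle factor that is at most 0 and outer factors that are at least 0, against
0 < [turn m]. *)
Lemma turn_gt0_SD {R : realType} (m : mesh R) : 0 < turn m -> SD m.
Proof.
move=> turn_gt0.
have [ctr [r [c1 c c2]]] := circumcircle_exists m (lt0r_neq0 turn_gt0).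
have r_gt0 : 0 < r.
  rewrite lt_neqAle -c dist_ge0 andbT eq_sym; apply/eqP => r0.
  have at_o p : dist p ctr = r -> p 0 0 = ctr 0 0 /\ p 1 0 = ctr 1 0.
    rewrite -c r0 => /(congr1 (fun d => d ^+ 2)); rewrite dist_sqr expr0n /=.
    move/eqP; rewrite paddr_eq0 ?sqr_ge0 // !sqrf_eq0 !subr_eq0.
    by case/andP => /eqP -> /eqP ->.
  have [a1 b1] := at_o _ c1; have [a b] := at_o _ c.
  by move: turn_gt0; rewrite /turn a1 b1 a b !subrr !mul0r subrr ltxx.
have [t1 [_ _ e1]] := circle_pt_exists _ _ _ 0 r_gt0 c1.
have [t [t1t tt1 e]] := circle_pt_exists _ _ _ t1 r_gt0 c.
have [t2 [t1t2 t2t1 e2]] := circle_pt_exists _ _ _ t1 r_gt0 c2.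
exists ctr, r, t1, t, t2; split=> //.
have turnE := turn_circle _ _ _ _ _ _ e1 e e2.
have sin_ge x : 0 <= x -> x < 2 * pi -> 0 <= sin (x / 2).
  by move=> x0 x2pi; apply: sin_ge0_pi; apply/andP; split; lra.
split=> //.
  rewrite lt_neqAle t1t andbT; apply/eqP => eq_t.
  by move: turn_gt0; rewrite turnE eq_t subrr mul0r sin0 mulr0 !mul0r ltxx.
rewrite ltNge; apply/negP => t2t.
move: turn_gt0; apply/negP; rewrite -leNgt turnE.
have -> : (t2 - t) / 2 = - ((t - t2) / 2) by field.
rewrite sinN mulrN mulNr oppr_le0.
by rewrite !mulr_ge0 ?sqr_ge0 ?sin_ge //; lra.
Qed.

(** * The diameter case *)

(** Thales: a centre at distance d2 / 2 from both ends of the second side is its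
midpoint, and the first point is on the circle with that side as a diameter
exactly when the angle there is right. *)
Lemma circumcircle_side2 {R : realType} (m : mesh R) (d1 d2 : R) :
    0 < d2 -> side1 m = d1 -> side2 m = d2 ->
  (exists o : 'cV[R]_2, is_circumcircle m o (d2 / 2)) <-> dotp m = d1 ^+ 2.
Proof.
move=> d2_gt0 s1 s2.
have d2_2 : 0 <= d2 / 2 by rewrite divr_ge0 // ltW.
have d1_sqr : d1 ^+ 2 = dist (first_pt m) (mid_pt m) ^+ 2 by rewrite -s1.
have d2_sqr : d2 ^+ 2 = dist (last_pt m) (mid_pt m) ^+ 2 by rewrite -s2.
have r_sqr : (d2 / 2) ^+ 2 = d2 ^+ 2 / 4 by field.
rewrite /dotp d1_sqr; rewrite !dist_sqr in d2_sqr *.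
split=> [[ctr [/distP -/(_ d2_2) c1 /distP -/(_ d2_2) c
  /distP -/(_ d2_2) c2]]|dotE].
  rewrite r_sqr d2_sqr in c1 c c2.
  have mid0 : (ctr 0 0 - (mid_pt m 0 0 + last_pt m 0 0) / 2) ^+ 2
    + (ctr 1 0 - (mid_pt m 1 0 + last_pt m 1 0) / 2) ^+ 2 = 0 by lra.
  move/eqP: mid0; rewrite paddr_eq0 ?sqr_ge0 // !sqrf_eq0 !subr_eq0.
  move=> /andP[/eqP o0 /eqP o1]; rewrite o0 o1 in c1 c.
  lra.
exists (\col_i ((mid_pt m i 0 + last_pt m i 0) / 2)).
by split; apply/distP => //; rewrite !mxE r_sqr d2_sqr; lra.
Qed.

(** Geometrically, k d2 / 2 is the sine of the angle at the first point, and
c = d1^2 says that this angle is right. *)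
Lemma curvature_side2 {R : realType} (k d1 d2 c s : R) :
    0 < d1 -> d1 < d2 -> 0 < k ->
    c ^+ 2 + s ^+ 2 = (d1 * d2) ^+ 2 ->
    4 * s ^+ 2 = (k * (d1 * d2)) ^+ 2 * (d1 ^+ 2 + d2 ^+ 2 - 2 * c) ->
  k * d2 <= 2 /\ (k * d2 = 2 <-> c = d1 ^+ 2).
Proof.
move=> d1_gt0 d12 k_gt0 cs_norm s_sqr.
have d2_gt0 : 0 < d2 by exact: lt_trans d12.
have kd2_gt0 : 0 < k * d2 by rewrite mulr_gt0.
have P_gt0 : 0 < d1 * d2 by rewrite mulr_gt0.
have c_le : c <= d1 * d2 by nra.
have gap : 0 < d1 ^+ 2 + d2 ^+ 2 - 2 * c.
  have : 0 < (d2 - d1) ^+ 2 by rewrite exprn_gt0 // subr_gt0.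
  nra.
have key : (4 - (k * d2) ^+ 2) * (d1 ^+ 2 * (d1 ^+ 2 + d2 ^+ 2 - 2 * c))
    = 4 * (d1 ^+ 2 - c) ^+ 2 by lra.
have den_gt0 : 0 < d1 ^+ 2 * (d1 ^+ 2 + d2 ^+ 2 - 2 * c).
  by rewrite mulr_gt0 ?exprn_gt0.
have fac : (4 - (k * d2) ^+ 2) = (2 - k * d2) * (2 + k * d2) by ring.
split.
  rewrite -subr_ge0 -(pmulr_lge0 _ (_ : 0 < 2 + k * d2)); last lra.
  rewrite -fac -(pmulr_lge0 _ den_gt0) key.
  by rewrite mulr_ge0 ?sqr_ge0.
split=> [kd2|cE].
  have coef0 : 4 - (k * d2) ^+ 2 = 0 by rewrite kd2; ring.
  move/esym/eqP: key; rewrite coef0 mul0r mulf_eq0 pnatr_eq0 /=.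
  by rewrite sqrf_eq0 subr_eq0 eq_sym => /eqP.
have dev0 : (d1 ^+ 2 - c) ^+ 2 = 0 by rewrite cE subrr expr0n.
move/eqP: key; rewrite dev0 mulr0 fac.
rewrite mulf_eq0 (gt_eqF den_gt0) orbF mulf_eq0 subr_eq0.
by rewrite (gt_eqF (_ : 0 < 2 + k * d2)) ?orbF => [/eqP|]; lra.
Qed.

(** * The count *)

Lemma ccw_shapesE {R : realType} (k d1 d2 : R) :
    0 < d1 -> d1 < d2 -> 0 < k -> k * d2 <= 2 ->
  shapes k d1 d2 `&` [set cs | 0 < cs.2] = [set` ccw_shapes k d1 d2] /\
  shapes k d1 d2 `&` ~` [set cs | 0 < cs.2] = [set` cw_shapes k d1 d2].
Proof.
move=> d1_gt0 d12 k_gt0 kd2.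
have ccw_pos cs : cs \in ccw_shapes k d1 d2 -> 0 < cs.2.
  by case/mapP=> e e_pm ->; exact: turn_root_gt0.
have cw_neg cs : cs \in cw_shapes k d1 d2 -> ~ 0 < cs.2.
  case/mapP=> e e_pm -> /=; rewrite oppr_gt0; apply/negP; rewrite -leNgt.
  exact: sqrtr_ge0.
rewrite shapesE //; split; apply/seteqP; split=> cs.
- move=> [in_cs /= cs_gt0].
  have : cs \in ccw_shapes k d1 d2 ++ cw_shapes k d1 d2 by [].
  by rewrite mem_cat => /orP[//|/cw_neg].
- move=> in_cs; split; last exact: ccw_pos.
  suff : cs \in ccw_shapes k d1 d2 ++ cw_shapes k d1 d2 by [].
  by rewrite mem_cat; apply/orP; left.
- move=> [in_cs /= cs_le0].
  have : cs \in ccw_shapes k d1 d2 ++ cw_shapes k d1 d2 by [].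
  by rewrite mem_cat => /orP[/ccw_pos|//].
- move=> in_cs; split; last exact: cw_neg.
  suff : cs \in ccw_shapes k d1 d2 ++ cw_shapes k d1 d2 by [].
  by rewrite mem_cat; apply/orP; right.
Qed.

Lemma classes_count {R : realType} (k d1 d2 : R) :
    0 < d1 -> d1 < d2 -> 0 < k -> k * d2 <= 2 ->
  let classes := congruence_classes (unequal_meshes k d1 d2) in
  let n := if k * d2 == 2 then 1%N else 2%N in
  [/\ classes #= `I_(n.*2),
      [set C | classes C /\ C `<=` @SD R] #= `I_n
    & [set C | classes C /\ C `<=` ~` @SD R] #= `I_n].
Proof.
move=> d1_gt0 d12 k_gt0 kd2 classes n.
have [n_ccw n_cw n_all] := size_undup_shapes _ _ _ d1_gt0 d12 k_gt0 kd2.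
have [ccwE cwE] := ccw_shapesE _ _ _ d1_gt0 d12 k_gt0 kd2.
have SDP (m : mesh R) : SD m <-> 0 < turn m.
  by split; [exact: SD_turn_gt0 | exact: turn_gt0_SD].
split.
- rewrite (card_eql (classes_card _ _ _ d1_gt0 d12)) shapesE // /n -n_all.
  exact: card_set_seq.
- rewrite (card_eql (classes_in_card k _ _ _ [set cs | 0 < cs.2] d1_gt0 d12
    (fun m _ => SDP m))).
  by rewrite ccwE /n -n_ccw; exact: card_set_seq.
- rewrite (card_eql (classes_in_card k _ _ _ (~` [set cs | 0 < cs.2])
    d1_gt0 d12 (fun m _ => not_iff_compat (SDP m)))).
  by rewrite cwE /n -n_cw; exact: card_set_seq.
Qed.

Theorem lemma4p23 (R : realType) (k d1 d2 : R)
    (d1_gt0 : 0 < d1) (d12 : d1 < d2) :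
  let meshes := unequal_meshes k d1 d2 in
  let classes := congruence_classes meshes in
  let classes_in (D : set (mesh R)) : set (set (mesh R)) :=
    [set C : set (mesh R) | classes C /\ C `<=` D]%classic in
  [/\ classes #<= `I_4,
      0 < k -> (meshes !=set0 <-> k * d2 <= 2),
      0 < k -> forall m : mesh R, meshes m ->
        (k * d2 = 2 <-> exists o : 'cV[R]_2, is_circumcircle m o (d2 / 2)),
      k * d2 = 2 ->
        [/\ classes #= `I_2,
            classes_in (@SD R) #= `I_1
          & classes_in (~` (@SD R)) #= `I_1]
    & 0 < k -> meshes !=set0 -> k * d2 <> 2 ->
        [/\ classes #= `I_4,
            classes_in (@SD R) #= `I_2
          & classes_in (~` (@SD R)) #= `I_2]].
Proof.
move=> meshes classes classes_in.
have d2_gt0 : 0 < d2 by exact: lt_trans d12.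
have bound m : 0 < k -> meshes m ->
    k * d2 <= 2 /\ (k * d2 = 2 <-> dotp m = d1 ^+ 2).
  move=> k_gt0 m_in.
  have [_ cs_norm s_sqr] := shape_in_shapes _ _ _ _ d1_gt0 d2_gt0 m_in.
  exact: curvature_side2 cs_norm s_sqr.
split.
- rewrite (card_le_eql (classes_card _ _ _ d1_gt0 d12)).
  apply: card_le_trans (subset_card_le (shapes_sub _ _ _ d1_gt0 d2_gt0)) _.
  by rewrite (card_le_eql (card_set_seq _)) card_le_II
    (leq_trans (size_undup _)).
- move=> k_gt0; split=> [[m m_in]|kd2]; first exact: (bound m k_gt0 m_in).1.
  have [|m m_in _] := shape_realized k _ _
    (dot_root k d1 d2 1, turn_root k d1 d2 1) d1_gt0 d12; last by exists m.
  by rewrite shapesE //= mem_head.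
- move=> k_gt0 m m_in; have [_ ->] := bound m k_gt0 m_in.
  by case: m_in => _ _ s1 s2; rewrite (circumcircle_side2 _ _ _ d2_gt0 s1 s2).
- move=> kd2.
  have k_gt0 : 0 < k by rewrite -(pmulr_lgt0 _ d2_gt0) kd2.
  have := classes_count k _ _ d1_gt0 d12 k_gt0.
  by rewrite kd2 eqxx lexx; exact.
- move=> k_gt0 [m m_in] kd2_neq.
  have [kd2 _] := bound m k_gt0 m_in.
  have := classes_count k _ _ d1_gt0 d12 k_gt0 kd2.
  by rewrite (introF eqP kd2_neq).
Qed.
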